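(* Let $D\subseteq\mathbb{C}$ be a domain in the upper half-plane, let $\Omega_D=\{x=x_0+\underline{x}\in\mathbb{R}^6:(x_0,|\underline{x}|)\in D\}$, and let $\breve f^\circ_0(x)=A(x_0,r)+\underline{\omega}B(x_0,r)$ be an axially polyanalytic function of order three on $\Omega_D$. Then $A=A(x_0,r)$ and $B=B(x_0,r)$ satisfy the system $$\begin{cases} \partial_{x_0}^3A+\partial_r^3B-3\partial_{x_0}^2\partial_rB-3\partial_{x_0}\partial_r^2A-\dfrac{12}r\partial_{x_0}^2B-\dfrac{12}r\partial_{x_0}\partial_rA+8\dfrac{\partial_r^2B}{r}+8\dfrac{\partial_rB}{r^2}-8\dfrac{B}{r^3}=0,\\[2mm] \partial_{x_0}^3B-\partial_r^3A+3\partial_{x_0}^2\partial_rA-3\partial_{x_0}\partial_r^2B-12\dfrac{\partial_{x_0}\partial_rB}{r}+12\dfrac{\partial_{x_0}B}{r^2}-4\dfrac{\partial_r^2A}{r}+\dfrac4{r^2}\partial_rA=0. \end{cases}$$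
   Context: $\mathbb{R}_5$ is the real Clifford algebra generated by $e_1,\dots,e_5$ with $e_i^2=-1$, $e_ie_j=-e_je_i$ for $i\ne j$. $\mathbb{R}^6$ is identified with paravectors $x=x_0+\underline{x}$, $\underline{x}=\sum_{i=1}^5x_ie_i=r\underline{\omega}$ with $r=|\underline{x}|>0$ and $\underline{\omega}\in\mathbb{S}=\{\underline{x}:|\underline{x}|=1\}$. A function $f:\Omega_D\to\mathbb{R}_5$ is of axial type if $f(x)=A(x_0,r)+\underline{\omega}B(x_0,r)$ with $A,B$ $\mathbb{R}_5$-valued and independent of $\underline{\omega}$. $\mathcal{D}f=\partial_{x_0}f+\sum_{i=1}^5e_i\partial_{x_i}f$. An axially polyanalytic function of order three is a function of axial type, of class $\mathcal{C}^3$, with $\mathcal{D}^3f=0$ on $\Omega_D$. *)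

(* Defs.v *)
From HB Require Import structures.
From mathcomp Require Import all_boot all_order all_algebra.
From mathcomp Require Import all_classical all_reals all_analysis.
From mathcomp Require Import ring.

Set Implicit Arguments.
Unset Strict Implicit.
Unset Printing Implicit Defensive.

Import Order.TTheory GRing.Theory Num.Theory.
Import numFieldNormedType.Exports.

Local Open Scope classical_set_scope.
Local Open Scope ring_scope.

Definition symdiff (n : nat) (S T : {set 'I_n}) : {set 'I_n} :=
  ((S :\: T) :|: (T :\: S))%SET.

(* e_S e_T = (-1)^k e_(S symdiff T), where k counts the pairs (i, j) of S x T
   with j <= i: every pair with j < i costs a transposition, every common index
   costs a factor e_i^2 = -1. *)
Definition blade_odd (n : nat) (S T : {set 'I_n}) : bool :=
  odd #|[set p in finset.setX S T | (p.2 <= p.1)%N]%SET|.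

(* The real Clifford algebra with n generators of square -1, as the real vector
   space with basis (e_S), where e_S = e_(i_1) ... e_(i_k) for
   S = {i_1 < ... < i_k}; see blade_prod below. Its norm is the sup norm of the
   coordinates and is only used for its topology. *)
Definition clifford (R : realType) (n : nat) : Type :=
  'rV[R]_#|{set 'I_n}|.

HB.instance Definition _ (R : realType) (n : nat) :=
  NormedModule.copy (clifford R n) 'rV[R]_#|{set 'I_n}|.

Section CliffordAlgebra.
Variables (R : realType) (n : nat).
Implicit Types (S T U : {set 'I_n}) (a b c : clifford R n).

Definition clcoord a S : R := (a : 'rV[R]_#|{set 'I_n}|) 0 (enum_rank S).

Definition blade S : clifford R n :=
  (delta_mx 0 (enum_rank S) : 'rV[R]_#|{set 'I_n}|).

Definition clmul a b : clifford R n :=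
  \sum_(S : {set 'I_n}) \sum_(T : {set 'I_n})
    ((-1) ^+ blade_odd S T * (clcoord a S * clcoord b T))
      *: blade (symdiff S T).

Lemma in_symdiff S T i : (i \in symdiff S T) = (i \in S) (+) (i \in T).
Proof. by rewrite !inE; case: (i \in S); case: (i \in T). Qed.

Lemma symdiffA : associative (@symdiff n).
Proof. by move=> S T U; apply/setP => i; rewrite !in_symdiff addbA. Qed.

Lemma symdiffC : commutative (@symdiff n).
Proof. by move=> S T; apply/setP => i; rewrite !in_symdiff addbC. Qed.

Lemma symdiff0 : right_id finset.set0 (@symdiff n).
Proof. by move=> S; apply/setP => i; rewrite in_symdiff inE addbF. Qed.

Lemma symdiffv S : symdiff S S = finset.set0.
Proof. by apply/setP => i; rewrite in_symdiff inE addbb. Qed.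

Lemma symdiffK S : involutive (symdiff S).
Proof.
by move=> T; apply/setP => i; rewrite !in_symdiff addbA addbb addFb.
Qed.

Lemma blade_oddE S T :
  blade_odd S T = \big[addb/false]_(p : 'I_n * 'I_n)
    ((p.1 \in S) && (p.2 \in T) && (p.2 <= p.1)%N).
Proof.
rewrite /blade_odd -sum1_card big_mkcond /=.
elim/big_rec2: _ => // p m b _ ih.
rewrite !inE oddD ih; congr (_ (+) _).
by case: ifP.
Qed.

Lemma blade_oddDl S T U :
  blade_odd (symdiff S T) U = blade_odd S U (+) blade_odd T U.
Proof.
rewrite !blade_oddE -big_split; apply: eq_bigr => p _ /=.
by rewrite in_symdiff; do ![case: (_ \in _)]; rewrite //= ?addbb ?addbF.
Qed.

Lemma blade_oddDr S T U :
  blade_odd S (symdiff T U) = blade_odd S T (+) blade_odd S U.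
Proof.
rewrite !blade_oddE -big_split; apply: eq_bigr => p _ /=.
by rewrite in_symdiff; do ![case: (_ \in _)]; rewrite //= ?addbb ?addbF.
Qed.

Lemma blade_odd0l T : blade_odd finset.set0 T = false.
Proof. by rewrite blade_oddE big1 // => p _; rewrite inE. Qed.

Lemma blade_odd0r S : blade_odd S finset.set0 = false.
Proof. by rewrite blade_oddE big1 // => p _; rewrite inE andbF. Qed.

Lemma clcoordD a b S : clcoord (a + b) S = clcoord a S + clcoord b S.
Proof. by rewrite /clcoord mxE. Qed.

Lemma clcoordZ (k : R) a S : clcoord (k *: a) S = k * clcoord a S.
Proof. by rewrite /clcoord mxE. Qed.

Lemma clcoord_blade S T : clcoord (blade S) T = (S == T)%:R.
Proof.
by rewrite /clcoord /blade mxE eqxx /= (inj_eq enum_rank_inj) eq_sym.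
Qed.

Lemma clcoord_sum (I : Type) (r : seq I) (P : pred I) (F : I -> clifford R n)
    S : clcoord (\sum_(i <- r | P i) F i) S = \sum_(i <- r | P i) clcoord (F i) S.
Proof.
elim/big_rec2: _ => [|i x y _ <-]; first by rewrite /clcoord mxE.
by rewrite clcoordD.
Qed.

Lemma clcoordP a b : (forall S, clcoord a S = clcoord b S) -> a = b.
Proof.
by move=> ab; apply/rowP => i; have := ab (enum_val i); rewrite /clcoord enum_valK.
Qed.

Lemma clmulE a b U :
  clcoord (clmul a b) U = \sum_(S : {set 'I_n})
    (-1) ^+ blade_odd S (symdiff S U) * (clcoord a S * clcoord b (symdiff S U)).
Proof.
rewrite clcoord_sum; apply: eq_bigr => S _.
rewrite clcoord_sum (bigD1 (symdiff S U)) //= clcoordZ clcoord_blade.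
rewrite symdiffK eqxx mulr1 big1 ?addr0 // => T neT.
rewrite clcoordZ clcoord_blade; case: eqP => [eqU|]; last by rewrite mulr0.
by move: neT; rewrite -eqU symdiffK eqxx.
Qed.

Lemma clmulA : associative clmul.
Proof.
move=> a b c; apply: clcoordP => U; rewrite !clmulE.
under eq_bigr => S _ do rewrite clmulE !mulr_sumr.
under [RHS]eq_bigr => S _ do rewrite clmulE mulr_suml mulr_sumr.
rewrite [RHS]exchange_big /=; apply: eq_bigr => S _.
rewrite [RHS](reindex_inj (inv_inj (symdiffK S))) /=; apply: eq_bigr => T _.
rewrite symdiffK symdiffA [symdiff T S]symdiffC.
set b1 := blade_odd S _; set b2 := blade_odd T _.
set b3 := blade_odd S T; set b4 := blade_odd _ _.
have : (-1) ^+ b1 * (-1) ^+ b2 = (-1) ^+ b3 * (-1) ^+ b4 :> R.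
  rewrite -!signr_addb /b1 /b2 /b3 /b4 -symdiffA !blade_oddDr !blade_oddDl.
  by do ![case: (blade_odd _ _)].
move: (_ ^+ b1) (_ ^+ b2) (_ ^+ b3) (_ ^+ b4) => s1 s2 s3 s4 es.
by ring: es.
Qed.

Lemma clmul1l : left_id (blade finset.set0) clmul.
Proof.
move=> a; apply: clcoordP => U; rewrite clmulE (bigD1 finset.set0) //=.
rewrite clcoord_blade eqxx mul1r blade_odd0l mul1r symdiffC symdiff0.
rewrite big1 ?addr0 // => S neS.
by rewrite clcoord_blade eq_sym (negbTE neS) mul0r mulr0.
Qed.

Lemma clmul1r : right_id (blade finset.set0) clmul.
Proof.
move=> a; apply: clcoordP => U; rewrite clmulE (bigD1 U) //=.
rewrite symdiffv clcoord_blade eqxx mulr1 blade_odd0r mul1r.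
rewrite big1 ?addr0 // => S neS.
rewrite clcoord_blade; case: eqP => [eq0|]; last by rewrite !mulr0.
have : symdiff S (symdiff S U) = S by rewrite -eq0 symdiff0.
rewrite symdiffK => eqU.
by rewrite eqU eqxx in neS.
Qed.

Lemma clmulDl : left_distributive clmul +%R.
Proof.
move=> a b c; apply: clcoordP => U; rewrite clcoordD !clmulE -big_split.
by apply: eq_bigr => S _ /=; rewrite clcoordD mulrDl mulrDr.
Qed.

Lemma clmulDr : right_distributive clmul +%R.
Proof.
move=> a b c; apply: clcoordP => U; rewrite clcoordD !clmulE -big_split.
by apply: eq_bigr => S _ /=; rewrite clcoordD !mulrDr.
Qed.

Lemma clone_neq0 : blade finset.set0 != 0.
Proof.
apply/eqP => /(congr1 (fun a => clcoord a finset.set0)).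
rewrite clcoord_blade eqxx /clcoord mxE => /eqP.
by rewrite oner_eq0.
Qed.

HB.instance Definition _ := GRing.Zmodule_isNzRing.Build (clifford R n)
  clmulA clmul1l clmul1r clmulDl clmulDr clone_neq0.

Lemma clscaleAl (k : R) a b : k *: (a * b) = (k *: a) * b.
Proof.
apply: clcoordP => U; rewrite clcoordZ !clmulE mulr_sumr.
by apply: eq_bigr => S _; rewrite clcoordZ mulrCA !mulrA.
Qed.

Lemma clscaleAr (k : R) a b : k *: (a * b) = a * (k *: b).
Proof.
apply: clcoordP => U; rewrite clcoordZ !clmulE mulr_sumr.
by apply: eq_bigr => S _; rewrite clcoordZ mulrCA [k * (_ * _)]mulrCA.
Qed.

HB.instance Definition _ :=
  GRing.Lmodule_isLalgebra.Build R (clifford R n) clscaleAl.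
HB.instance Definition _ :=
  GRing.Lalgebra_isAlgebra.Build R (clifford R n) clscaleAr.

Definition clgen (i : 'I_n) : clifford R n := blade [set i]%SET.

Lemma blade0 : blade finset.set0 = 1. Proof. by []. Qed.

Lemma bladeM S T :
  blade S * blade T = (-1) ^+ blade_odd S T *: blade (symdiff S T).
Proof.
apply: clcoordP => U; rewrite clmulE clcoordZ (bigD1 S) //=.
rewrite !clcoord_blade eqxx mul1r big1 ?addr0 => [|V neV].
  case: (T =P symdiff S U) => [->|neT]; first by rewrite symdiffK eqxx.
  case: eqP => [eqU|]; last by rewrite !mulr0.
  by case: neT; rewrite -eqU symdiffK.
by rewrite clcoord_blade eq_sym (negbTE neV) mul0r mulr0.
Qed.

Lemma blade_odd1 (i j : 'I_n) :
  blade_odd [set i]%SET [set j]%SET = (j <= i)%N.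
Proof.
rewrite blade_oddE (bigD1 (i, j)) //= !inE !eqxx big1 ?addbF //.
by move=> [k l] /=; rewrite !inE xpair_eqE => /negbTE ->.
Qed.

Lemma clgen_sqr (i : 'I_n) : clgen i ^+ 2 = -1.
Proof.
by rewrite expr2 bladeM blade_odd1 leqnn symdiffv expr1 scaleN1r blade0.
Qed.

Lemma clgen_anticomm (i j : 'I_n) :
  i != j -> clgen i * clgen j = - (clgen j * clgen i).
Proof.
move=> ij; rewrite !bladeM !blade_odd1 symdiffC -scaleNr; congr (_ *: _).
by case: (ltngtP i j) => [||/val_inj eij]; rewrite ?opprK //; rewrite eij eqxx in ij.
Qed.

Lemma blade_prod S : blade S = \prod_(i in S) clgen i.
Proof.
pose s := enum S.
have sP : sorted (fun i j : 'I_n => (i < j)%N) s.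
  rewrite /s {1}/enum_mem; apply: sorted_filter; first by move=> ? ? ?; apply: ltn_trans.
  rewrite -enumT -(@sorted_map _ _ val ltn) val_enum_ord.
  exact: iota_ltn_sorted.
rewrite -big_filter deprecated_filter_index_enum -/s.
have -> : S = [set i in s]%SET by apply/setP => i; rewrite inE mem_enum.
clearbody s.
elim: s sP => [_|i s ih].
  by rewrite big_nil; congr blade; apply/setP => i; rewrite !inE.
move=> /[dup] sP /path_sorted /ih; rewrite big_cons => <-.
rewrite bladeM.
have lt_s : {in s, forall j : 'I_n, (i < j)%N}.
  apply/allP; apply: order_path_min sP => ? ? ?; exact: ltn_trans.
have -> : blade_odd [set i]%SET [set j in s]%SET = false.
  rewrite blade_oddE big1 // => -[k l] _ /=; rewrite !inE.
  by case: eqP => //= ->; case: (boolP (l \in s)) => //= /lt_s; case: ltngtP.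
rewrite expr0 scale1r; congr blade; apply/setP => k.
rewrite in_symdiff !inE; case: eqP => //= ->.
by case: (boolP (i \in s)) => // /lt_s; rewrite ltnn.
Qed.

End CliffordAlgebra.

(* f is of class C^k on the open set U, in terms of the iterated partial
   derivatives along the vectors of the basis E. *)
Fixpoint class_C (R : realType) (V W : normedModType R) (E : set V) (k : nat)
    (U : set V) (f : V -> W) : Prop :=
  {in U, continuous f} /\
  match k with
  | 0 => True
  | k'.+1 => forall v, E v ->
      (forall x, U x -> derivable f x v) /\ class_C E k' U ('D_v f)
  end.

Section Paravectors.
Variables (R : realType) (n : nat).
Implicit Types x : 'rV[R]_n.+1.

(* The paravector x_0 + x_1 e_1 + ... + x_n e_n is the row (x_0, ..., x_n); the
   coordinate x_i, 1 <= i, sits at index lift ord0 of the 0-based generator. *)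
Definition pv_scal x : R := x 0 ord0.

Definition pv_vect x : clifford R n :=
  \sum_(i < n) x 0 (lift ord0 i) *: clgen R i.

(* The Euclidean norm of the vector part ('rV carries the sup norm). *)
Definition pv_rad x : R := Num.sqrt (\sum_(i < n) x 0 (lift ord0 i) ^+ 2).

Definition pv_omega x : clifford R n := (pv_rad x)^-1 *: pv_vect x.

Definition pv_basis : set 'rV[R]_n.+1 := range (fun i => delta_mx 0 i).

Definition dirac (f : 'rV[R]_n.+1 -> clifford R n) (x : 'rV[R]_n.+1) :
    clifford R n :=
  'D_(delta_mx 0 ord0) f x +
  \sum_(i < n) clgen R i * 'D_(delta_mx 0 (lift ord0 i)) f x.

Definition Omega (D : set (R * R)) : set 'rV[R]_n.+1 :=
  [set x | D (pv_scal x, pv_rad x)].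

Definition axial_components (D : set (R * R))
    (f : 'rV[R]_n.+1 -> clifford R n) (A B : R * R -> clifford R n) : Prop :=
  forall x, Omega D x ->
    f x = A (pv_scal x, pv_rad x) + pv_omega x * B (pv_scal x, pv_rad x).

Definition axially_polyanalytic (m : nat) (D : set (R * R))
    (f : 'rV[R]_n.+1 -> clifford R n) : Prop :=
  [/\ exists A B, axial_components D f A B,
      class_C pv_basis m (Omega D) f &
      forall x, Omega D x -> iter m dirac f x = 0].

End Paravectors.

(* The complex plane is R * R, the point (u, v) standing for u + iv. *)
Definition upper_domain (R : realType) (D : set (R * R)) : Prop :=
  [/\ open D, connected D, D !=set0 & forall p, D p -> 0 < p.2].

Definition plane_basis (R : realType) : set (R * R) :=
  [set (1, 0); (0, 1)].
Arguments plane_basis R : clear implicits.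

Definition dx0 (R : realType) (W : normedModType R) (F : R * R -> W) :
  R * R -> W := 'D_((1, 0) : R * R) F.

Definition dr (R : realType) (W : normedModType R) (F : R * R -> W) :
  R * R -> W := 'D_((0, 1) : R * R) F.

(* Main.v *)
Require Import Defs.
From mathcomp Require Import all_boot all_order all_algebra.
From mathcomp Require Import all_classical all_reals all_analysis.
From mathcomp Require Import ring.
Import Order.TTheory GRing.Theory Num.Theory.
Import numFieldNormedType.Exports.
Local Open Scope classical_set_scope.
Local Open Scope ring_scope.

(** Along the unit sphere of vector parts, a function of axial type is determined
by its two components on the half-plane r > 0, and the Dirac operator acts on
these components by a first order operator with coefficients in r. In
dimension n + 1, the identities
  [sum_i e_i d_i A = omega (d_r A)] and
  [sum_i e_i d_i (omega B) = - d_r B - ((n - 1) / r) B],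
which follow from [sum_i e_i e_i = - n] and from the fact that the vector part
squares to [- r ^ 2], show that the components of [D f] are
  [d_0 A - d_r B - ((n - 1) / r) B] and [d_0 B + d_r A]
(lemma [dirac_axial]). The derivatives needed here are only along the vectors of
the basis; along such a vector either x_0 or r is constant, so the chain rule in
one variable is enough.

Conversely, the components of an axial function are recovered from its values at
the two points with vector part [r e_1] and [- r e_1], where omega is [e_1] and
[- e_1], as a half-sum and a half-difference. Therefore the components of a
function of class C^3 are of class C^3 (lemma [class_C_axial]), and the components
of a function that vanishes are zero (lemma [axial_components_eq0]).

Applying [dirac_axial] three times, the two components of [D^3 f = 0] vanish, and
they are the third iterate of the first order operator at (A, B). Its expansion
(lemma [axial_dirac3]) is the announced system once n = 5. The expansion uses the
symmetry of mixed derivatives, which is proved for real functions by applying the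
mean value theorem twice to a second difference (lemma [derive_comm]) and is
transferred to Clifford-valued functions coordinate by coordinate. *)

Set Implicit Arguments.
Unset Strict Implicit.
Unset Printing Implicit Defensive.

(** * Derivatives along a vector *)

Section DirectionalDerivative.
Context {R : realType} {V : normedModType R}.

Lemma is_deriveP {U W : normedModType R} (x v : U) (f : U -> W) (df : W) :
  is_derive x v f df <->
  (fun h => h^-1 *: (f (h *: v + x) - f x)) @ 0^' --> df.
Proof.
split=> [[fv <-]|fv]; first exact: fv.
by split; [apply/cvg_ex; exists df|apply: cvg_lim].
Qed.

(** A derivative along v is an ordinary derivative on a line parallel to v: the
theorems on functions of one real variable apply to it, without any total
differentiability. *)
Lemma is_derive_line {W : normedModType R} (q v : V) (s : R) (f : V -> W)
    (df : W) :
  is_derive (s *: v + q) v f df <->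
  is_derive s (1 : R) (fun h : R => f (h *: v + q)) df.
Proof.
suff e : (fun h : R => h^-1 *: (f (h *: v + (s *: v + q)) - f (s *: v + q))) =
    (fun h => h^-1 *: (f ((h *: (1 : R) + s : R) *: v + q) - f (s *: v + q))).
  by split=> /is_deriveP fv; apply/is_deriveP; move: fv; rewrite e.
by apply/funext => h; rewrite [_%:A]mulr1 scalerDl addrA.
Qed.

Lemma is_derive_line0 {W : normedModType R} (x v : V) (f : V -> W) (df : W) :
  is_derive x v f df <->
  is_derive (0 : R) (1 : R) (fun h : R => f (h *: v + x)) df.
Proof.
rewrite -{1}[x]add0r -[X in X + x](scale0r v).
exact: is_derive_line.
Qed.

Lemma is_derive_comp1 {W : normedModType R} (x v : V) (k : V -> R) (f : R -> W)
    (dk : R) (df : W) :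
  is_derive x v k dk -> is_derive (k x) (1 : R) f df ->
  is_derive x v (f \o k) (dk *: df).
Proof.
move=> /is_derive_line0 dk1 df1; apply/is_derive_line0.
set l := fun h : R => k (h *: v + x).
have l0 : l 0 = k x by rewrite /l scale0r add0r.
have dl : differentiable l (0 : R) by apply/derivable1_diffP; case: dk1.
have dfl : differentiable f (l 0) by rewrite l0; apply/derivable1_diffP; case: df1.
have dc : differentiable (f \o l) (0 : R) by exact: differentiable_comp.
rewrite -[fun h : R => _]/(f \o l).
split; first exact/derivable1_diffP.
have l1 : 'd l (0 : R) 1 = dk by rewrite -deriveE //; case: dk1.
have f1 : 'd f (l 0) 1 = df by rewrite -deriveE // l0; case: df1.
by rewrite deriveE // diff_comp //= l1 -[X in 'd f _ X]mulr1 [LHS]linearZ /= f1.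
Qed.

(** The difference quotients commute with L, so that continuity of L is all that
is needed. Stated for an unbundled map, to be applied to coordinates and to
one-sided multiplications. *)
Lemma is_derive_linear {W W' : normedModType R} (L : W -> W')
    (x v : V) (f : V -> W) (df : W) :
  linear L -> continuous L -> is_derive x v f df ->
  is_derive x v (L \o f) (L df).
Proof.
move=> Ll Lc /is_deriveP fv; apply/is_deriveP.
have LB a b : L (a - b) = L a - L b.
  by have := Ll 1 (a - b) b; rewrite !scale1r subrK => ->; rewrite addrK.
have L0 : L 0 = 0 by rewrite -(subrr (0 : W)) LB subrr.
have LZ k a : L (k *: a) = k *: L a by rewrite -[k *: a]addr0 Ll L0 addr0.
rewrite (_ : (fun h => _) = L \o (fun h => h^-1 *: (f (h *: v + x) - f x))).
  exact: (cvg_comp _ _ fv (Lc df)).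
by apply/funext => h /=; rewrite LZ LB.
Qed.

Lemma is_derive_scale {W : normedModType R} (x v : V) (k : V -> R) (f : V -> W)
    (dk : R) (df : W) :
  is_derive x v k dk -> is_derive x v f df ->
  is_derive x v (fun y => k y *: f y) (k x *: df + dk *: f x).
Proof.
move=> kv fv; apply/is_deriveP.
rewrite (_ : (fun h => _) = (fun h =>
  k (h *: v + x) *: (h^-1 *: (f (h *: v + x) - f x)) +
  (h^-1 *: (k (h *: v + x) - k x)) *: f x)); last first.
  apply/funext => h.
  rewrite scalerA [k _ * _]mulrC -!scalerA -scalerDr; congr (_ *: _).
  by rewrite scalerBr scalerBl addrA subrK.
apply: cvgD; last first.
  by apply: cvgZr_tmp; move/is_deriveP: kv.
apply: cvgZ; last by move/is_deriveP: fv.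
have : {for 0, continuous (fun h : R => k (h *: v + x))}.
  apply/differentiable_continuous/derivable1_diffP.
  by move/is_derive_line0: kv; case.
by move=> /continuous_withinNx; rewrite scale0r add0r.
Qed.

End DirectionalDerivative.

Lemma is_derive_dirZ (R : realType) (V W : normedModType R) (c : R)
    (x v : V) (f : V -> W)
    (df : W) :
  is_derive x v f df -> is_derive x (c *: v) f (c *: df).
Proof.
move=> /is_derive_line0 fv; apply/is_derive_line0.
have -> : (fun h : R => f (h *: (c *: v) + x)) =
    (fun t => f (t *: v + x)) \o (fun h : R => h * c).
  by apply/funext => h /=; rewrite scalerA.
apply: is_derive_comp1; last by rewrite mul0r.
apply/is_deriveP; rewrite (_ : (fun h => _) = (fun h => h^-1 * h * c)); last first.
  by apply/funext => h; rewrite [_%:A]mulr1 addr0 mul0r subr0 [LHS]mulrA.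
apply: cvg_near_cst; near=> h.
rewrite mulVf ?mul1r //.
by near: h; exact: nbhs_dnbhs_neq.
Unshelve. all: by end_near. Qed.

(** * Symmetry of mixed derivatives *)

Lemma MVT_line (R : realType) (V : normedModType R) (phi : V -> R) (v q : V)
    (h : R) :
  0 < h ->
  (forall s, 0 <= s <= h -> derivable phi (s *: v + q) v) ->
  exists2 s, 0 <= s <= h & phi (h *: v + q) - phi q = h * 'D_v phi (s *: v + q).
Proof.
move=> h0 dphi.
have dl s : s \in `[0, h] ->
    is_derive s 1 (fun t => phi (t *: v + q)) ('D_v phi (s *: v + q)).
  rewrite in_itv /= => sh.
  exact: (is_derive_line _ _ _ _ _).1 (derivableP (dphi s sh)).
pose f (t : R) : R := phi (t *: v + q); pose df (t : R) : R := 'D_v phi (t *: v + q).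
have dfo : forall x : R, x \in `]0, h[ -> is_derive x 1 f (df x).
  by move=> s sh; apply: dl; apply: subset_itv_oo_cc sh.
have fc : {within `[0, h], continuous f}.
  by apply: derivable_within_continuous => s /dl; case.
have [s] := MVT h0 dfo fc.
rewrite in_itv /= /f /df scale0r add0r subr0 mulrC => /andP[s0 sh] e.
by exists s => //; rewrite !ltW.
Qed.

(** The second difference of g over the parallelogram spanned by h v and h w is the
increment along v of x |-> g (h w + x) - g x. The mean value theorem along v
gives h times a difference of derivatives along v, which is in turn an increment
along w. *)
Lemma second_difference (R : realType) (V : normedModType R) (g : V -> R)
    (v w p : V) (h : R) :
  0 < h ->
  (forall s t, 0 <= s <= h -> 0 <= t <= h ->
    derivable g (s *: v + (t *: w + p)) v /\
    derivable ('D_v g) (s *: v + (t *: w + p)) w) ->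
  exists s t, [/\ 0 <= s <= h, 0 <= t <= h &
    g (h *: v + (h *: w + p)) - g (h *: v + p) - (g (h *: w + p) - g p) =
    h ^+ 2 * 'D_w ('D_v g) (s *: v + (t *: w + p))].
Proof.
move=> h0 dg.
have h00 : (0 : R) <= 0 <= h by rewrite lexx ltW.
have hh : 0 <= h <= h by rewrite lexx ltW.
pose phi x := g (h *: w + x) - g x.
have gw s : 0 <= s <= h ->
    is_derive (s *: v + p) v (fun x => g (h *: w + x))
              ('D_v g (s *: v + (h *: w + p))).
  move=> sh; apply: (is_derive_line _ _ _ _ _).2.
  rewrite (_ : (fun _ => _) = fun t : R => g (t *: v + (h *: w + p))).
    apply: (is_derive_line _ _ _ _ _).1.
    exact/derivableP/(dg s h sh hh).1.
  by apply/funext => t; rewrite addrCA.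
have g0 s : 0 <= s <= h -> is_derive (s *: v + p) v g ('D_v g (s *: v + p)).
  move=> sh; apply/derivableP; have [+ _] := dg s 0 sh h00.
  by rewrite scale0r add0r.
have dphi s : 0 <= s <= h -> is_derive (s *: v + p) v phi
    ('D_v g (s *: v + (h *: w + p)) - 'D_v g (s *: v + p)).
  by move=> sh; apply: is_deriveB; [exact: gw|exact: g0].
have dphi1 s : 0 <= s <= h -> derivable phi (s *: v + p) v by case/dphi.
have [s sh phiE] := MVT_line h0 dphi1.
have [t th psiE] : exists2 t, 0 <= t <= h &
    'D_v g (h *: w + (s *: v + p)) - 'D_v g (s *: v + p) =
    h * 'D_w ('D_v g) (t *: w + (s *: v + p)).
  apply: (@MVT_line R V ('D_v g) w (s *: v + p) h h0).
  by move=> t th; rewrite addrCA; exact: (dg s t sh th).2.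
have phi' : 'D_v phi (s *: v + p) = h * 'D_w ('D_v g) (s *: v + (t *: w + p)).
  by rewrite addrCA -psiE addrCA; case: (dphi s sh).
exists s, t; split; [exact: sh|exact: th|].
by rewrite expr2 -mulrA -phi' -phiE /phi [h *: w + (h *: v + p)]addrCA.
Qed.

(** The second difference of g over a small parallelogram is symmetric in v and w.
By [second_difference] it gives one mixed derivative at some point near p and
the other mixed derivative at another point near p, so that the continuity of
both at p forces them to agree there. *)
Lemma derive_comm (R : realType) (V : normedModType R) (g : V -> R)
    (v w p : V) :
  (\forall q \near p, [/\ derivable g q v, derivable g q w,
     derivable ('D_v g) q w & derivable ('D_w g) q v]) ->
  {for p, continuous ('D_w ('D_v g))} -> {for p, continuous ('D_v ('D_w g))} ->
  'D_w ('D_v g) p = 'D_v ('D_w g) p.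
Proof.
have tri (a b c e : R) : `|a - c| < e / 2 -> `|b - c| < e / 2 -> `|a - b| <= e.
  move=> ac bc; rewrite -(subrKA c) [e]splitr (le_trans (ler_normD _ _)) //.
  by rewrite lerD // ltW // distrC.
move=> dg cvw cwv.
apply/eqP; rewrite -subr_eq0 -normr_le0; apply/ler_addgt0Pr => e e0.
rewrite add0r.
have e20 : 0 < e / 2 by rewrite divr_gt0.
have /cvgrPdist_lt /(_ _ e20) nvw := cvw.
have /cvgrPdist_lt /(_ _ e20) nwv := cwv.
have [d /= d0 dP] := (nbhs_ballP _ _).1 (filterI dg (filterI nvw nwv)).
(* This size of h keeps the whole parallelogram inside the ball of radius d. *)
pose h := d / 2 / (`|v| + `|w| + 1).
have n0 : 0 < `|v| + `|w| + 1 by rewrite ltr_wpDl // addr_ge0.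
have h0 : 0 < h by rewrite !divr_gt0.
have near_p s t : 0 <= s <= h -> 0 <= t <= h -> ball p d (s *: v + (t *: w + p)).
  move=> /andP[s0 sh] /andP[t0 th].
  rewrite -ball_normE /ball_ /= addrA opprD addrCA subrr addr0 normrN.
  rewrite (le_lt_trans (ler_normD _ _)) // !normrZ !ger0_norm //.
  apply: (@le_lt_trans _ _ (h * (`|v| + `|w| + 1))).
    by rewrite !mulrDr -[leLHS]addr0 !lerD ?ler_wpM2r // mulr_ge0 // ltW.
  by rewrite /h divfK ?gt_eqF // ltr_pdivrMr // ltr_pMr // ltr1n.
have [s [t [sh th e1]]] : exists s t, [/\ 0 <= s <= h, 0 <= t <= h &
    g (h *: v + (h *: w + p)) - g (h *: v + p) - (g (h *: w + p) - g p) =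
    h ^+ 2 * 'D_w ('D_v g) (s *: v + (t *: w + p))].
  apply: second_difference; first exact: h0.
  move=> s t sh th; have [[dv _ dvw _] _] := dP _ (near_p s t sh th).
  exact: conj dv dvw.
have [t' [s' [th' sh' e2]]] : exists s t, [/\ 0 <= s <= h, 0 <= t <= h &
    g (h *: w + (h *: v + p)) - g (h *: w + p) - (g (h *: v + p) - g p) =
    h ^+ 2 * 'D_v ('D_w g) (s *: w + (t *: v + p))].
  apply: second_difference; first exact: h0.
  move=> t' s' th' sh'; rewrite addrCA.
  have [[_ dw _ dwv] _] := dP _ (near_p s' t' sh' th').
  exact: conj dw dwv.
have e3 : 'D_w ('D_v g) (s *: v + (t *: w + p)) =
    'D_v ('D_w g) (s' *: v + (t' *: w + p)).
  have h2 : h ^+ 2 != 0 by rewrite expf_neq0 // gt_eqF.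
  apply: (mulfI h2).
  rewrite [s' *: v + (t' *: w + p)]addrCA.
  apply: (etrans (esym e1)); apply: (etrans _ e2).
  rewrite [h *: w + (h *: v + p)]addrCA.
  by move: (g _) (g _) (g _) (g _) => a1 a2 a3 a4; ring.
have [_ [lt1 _]] := dP _ (near_p s t sh th).
have [_ [_ lt2]] := dP _ (near_p s' t' sh' th').
rewrite -e3 in lt2; exact: tri lt1 lt2.
Qed.

(** * Functions of class C^k *)

Section ClassC.
Context {R : realType} {V : normedModType R} (E U : set V).
Hypothesis oU : open U.

Lemma class_C_continuous {W : normedModType R} k (f : V -> W) x :
  class_C E k U f -> U x -> {for x, continuous f}.
Proof. by case: k => [|k] [fc _] Ux; apply: fc; rewrite inE. Qed.

Lemma class_C_derivable {W : normedModType R} k (f : V -> W) v x :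
  class_C E k.+1 U f -> E v -> U x -> derivable f x v.
Proof. move=> [_ fE] Ev Ux; exact: (fE v Ev).1. Qed.

Lemma class_C_is_derive {W : normedModType R} k (f : V -> W) v x :
  class_C E k.+1 U f -> E v -> U x -> is_derive x v f ('D_v f x).
Proof. by move=> Cf Ev Ux; apply: derivableP; exact: class_C_derivable Cf Ev Ux. Qed.

Lemma class_C_derive {W : normedModType R} k (f : V -> W) v :
  class_C E k.+1 U f -> E v -> class_C E k U ('D_v f).
Proof. by move=> [_ fE] Ev; exact: (fE v Ev).2. Qed.

Lemma class_CW {W : normedModType R} k (f : V -> W) :
  class_C E k.+1 U f -> class_C E k U f.
Proof.
elim: k f => [|k ih] f [fc fE]; first by split.
split; first exact: fc.
by move=> v Ev; have [df Cf] := fE v Ev; split; [exact: df|exact: ih].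
Qed.

Lemma near_open_eq {T : Type} (f g : V -> T) x :
  (forall x, U x -> f x = g x) -> U x -> \forall y \near x, f y = g y.
Proof. by move=> fg Ux; apply: filterS (open_nbhs_nbhs (conj oU Ux)) => y /fg. Qed.

Lemma class_C_ext {W : normedModType R} k (f g : V -> W) :
  (forall x, U x -> f x = g x) -> class_C E k U f -> class_C E k U g.
Proof.
have cfg (f' g' : V -> W) : (forall x, U x -> f' x = g' x) ->
    {in U, continuous f'} -> {in U, continuous g'}.
  move=> fg fc x; rewrite inE => Ux; rewrite /continuous_at -(fg _ Ux).
  apply: cvg_trans (fc x (mem_set Ux)); apply: near_eq_cvg.
  exact: near_open_eq.
elim: k f g => [|k ih] f g fg [fc fE]; first by split; [exact: cfg fc|].
split; first exact: cfg fc.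
move=> v Ev; have [df Cf] := fE v Ev; split=> [x Ux|].
  by apply: near_eq_derivable (df x Ux); exact: near_open_eq.
by apply: ih Cf => x Ux; apply: near_eq_derive; exact: near_open_eq.
Qed.

(** The closure properties below rest on this rule: the derivatives may be
given by any formula that is valid on U, whatever its values outside U. *)
Lemma class_CI {W : normedModType R} k (f : V -> W) :
  (forall x, U x -> {for x, continuous f}) ->
  (forall v, E v -> exists2 df : V -> W,
     (forall x, U x -> is_derive x v f (df x)) & class_C E k U df) ->
  class_C E k.+1 U f.
Proof.
move=> fc fE; split=> [x|v Ev]; first by rewrite inE; exact: fc.
have [df dfE Cdf] := fE v Ev; split=> [x Ux|]; first by case: (dfE x Ux).
by apply: class_C_ext Cdf => x Ux; case: (dfE x Ux).
Qed.

Lemma class_CD {W : normedModType R} k (f g : V -> W) :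
  class_C E k U f -> class_C E k U g -> class_C E k U (fun x => f x + g x).
Proof.
have cD (f' g' : V -> W) k1 : class_C E k1 U f' -> class_C E k1 U g' ->
    forall x, U x -> {for x, continuous (fun x => f' x + g' x)}.
  move=> Cf Cg x Ux.
  exact: cvgD (class_C_continuous Cf Ux) (class_C_continuous Cg Ux).
elim: k f g => [|k ih] f g Cf Cg.
  by split=> // x; rewrite inE; exact: (cD _ _ _ Cf Cg).
apply: class_CI; first exact: (cD _ _ _ Cf Cg).
move=> v Ev; exists (fun x => 'D_v f x + 'D_v g x) => [x Ux|].
  exact: is_deriveD (class_C_is_derive Cf Ev Ux) (class_C_is_derive Cg Ev Ux).
exact: ih (class_C_derive Cf Ev) (class_C_derive Cg Ev).
Qed.

Lemma class_C_linear {W W' : normedModType R} (L : W -> W') k (f : V -> W) :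
  linear L -> continuous L -> class_C E k U f -> class_C E k U (L \o f).
Proof.
move=> Ll Lc.
have cL (f' : V -> W) k1 : class_C E k1 U f' ->
    forall x, U x -> {for x, continuous (L \o f')}.
  by move=> Cf x Ux; apply: continuous_comp (class_C_continuous Cf Ux) (Lc _).
elim: k f => [|k ih] f Cf; first by split=> // x; rewrite inE; exact: (cL _ _ Cf).
apply: class_CI; first exact: (cL _ _ Cf).
move=> v Ev; exists (L \o 'D_v f); last exact: ih (class_C_derive Cf Ev).
by move=> x Ux; exact: is_derive_linear Ll Lc (class_C_is_derive Cf Ev Ux).
Qed.

Lemma class_CZ {W : normedModType R} k (c : R) (f : V -> W) :
  class_C E k U f -> class_C E k U (fun x => c *: f x).
Proof.
apply: (@class_C_linear W W (fun w => c *: w)).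
  by move=> a u v; rewrite scalerDr !scalerA mulrC.
exact: scaler_continuous.
Qed.

Lemma class_CB {W : normedModType R} k (f g : V -> W) :
  class_C E k U f -> class_C E k U g -> class_C E k U (fun x => f x - g x).
Proof.
move=> Cf Cg; apply: class_C_ext (class_CD Cf (class_CZ (-1) Cg)) => x _.
by rewrite scaleN1r.
Qed.

End ClassC.

(** The vectors of the first basis need only go to multiples of vectors of the
second one, since a derivative along c w is c times the derivative along w; this
covers a reflection, which changes the sign of a basis vector. *)
Lemma class_C_comp_linear (R : realType) (V V' W : normedModType R)
    (E U : set V) (E' U' : set V') (iota : V' -> V) k (f : V -> W) :
  open U' -> linear iota -> continuous iota ->
  (forall x, U' x -> U (iota x)) ->
  (forall v, E' v -> exists c w, E w /\ iota v = c *: w) ->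
  class_C E k U f -> class_C E' k U' (f \o iota).
Proof.
move=> oU' il ic iU iE.
have ci (g : V -> W) k1 : class_C E k1 U g ->
    forall x, U' x -> {for x, continuous (g \o iota)}.
  move=> Cg x Ux.
  by apply: continuous_comp (ic _) (class_C_continuous Cg (iU _ Ux)).
elim: k f => [|k ih] f Cf; first by split=> // x; rewrite inE; exact: (ci _ _ Cf).
apply: (class_CI oU'); first exact: (ci _ _ Cf).
move=> v /iE[c [w [Ew iv]]].
exists (fun x => c *: 'D_w f (iota x)) => [x Ux|].
  have := is_derive_dirZ c (class_C_is_derive Cf Ew (iU _ Ux)).
  move=> /is_derive_line0 fd; apply/is_derive_line0.
  rewrite (_ : (fun h => _) = fun h : R => f (h *: (c *: w) + iota x)); first exact: fd.
  by apply/funext => t /=; rewrite il iv.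
exact: (class_CZ oU' c (ih _ (class_C_derive Cf Ew))).
Qed.

(** * Calculus of Clifford-valued functions *)

Lemma is_derive_bigsum (R : realType) (V W : normedModType R) (I : Type)
    (r : seq I) (f : I -> V -> W) (df : I -> W) (x v : V) :
  (forall i, is_derive x v (f i) (df i)) ->
  is_derive x v (fun y => \sum_(i <- r) f i y) (\sum_(i <- r) df i).
Proof.
move=> fv; elim: r => [|i r ih].
  rewrite big_nil (_ : (fun _ => _) = cst 0); first exact: is_derive_cst.
  by apply/funext => y; rewrite big_nil.
rewrite big_cons (_ : (fun _ => _) = f i + (fun y => \sum_(j <- r) f j y)).
  exact: is_deriveD (fv i) ih.
by apply/funext => y; rewrite big_cons.
Qed.

Section CliffordCalculus.
Context {R : realType} {n : nat}.
Implicit Types (a b : clifford R n) (S : {set 'I_n}).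

Lemma clcoord_linear S : linear (fun b : clifford R n => clcoord b S).
Proof. by move=> k a b; rewrite clcoordD clcoordZ. Qed.

Lemma clcoord_continuous S : continuous (fun b : clifford R n => clcoord b S).
Proof. exact: (@coord_continuous R 1 #|{set 'I_n}| 0 (enum_rank S)). Qed.

Lemma clifford_sum_blade b :
  b = \sum_(S : {set 'I_n}) clcoord b S *: blade R S.
Proof.
apply: clcoordP => T; rewrite clcoord_sum (bigD1 T) //= clcoordZ clcoord_blade.
rewrite eqxx mulr1 big1 ?addr0 // => S /negbTE ST.
by rewrite clcoordZ clcoord_blade ST mulr0.
Qed.

(** Writes the product as a sum of scalars times left multiplications, which
reduces the product rule to the one for a scalar factor. *)
Lemma clifford_mulE a b :
  a * b = \sum_(S : {set 'I_n}) clcoord a S *: (blade R S * b).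
Proof.
rewrite {1}[a]clifford_sum_blade mulr_suml; apply: eq_bigr => S _.
by rewrite -scalerAl.
Qed.

Lemma mull_linear a : linear (fun b => a * b).
Proof. by move=> k b c; rewrite mulrDr -scalerAr. Qed.

Lemma mull_continuous a : continuous (fun b => a * b).
Proof.
have -> : (fun b => a * b) =
    (fun b => \sum_(S : {set 'I_n}) clcoord b S *: (a * blade R S)).
  apply/funext => b; rewrite {1}[b]clifford_sum_blade mulr_sumr.
  by apply: eq_bigr => S _; rewrite -scalerAr.
apply: continuous_big => [|S _ b]; first exact: add_continuous.
exact: cvgZr_tmp (@clcoord_continuous S b).
Qed.

Context {V : normedModType R}.

Lemma is_derive_mull a (x v : V) (f : V -> clifford R n) df :
  is_derive x v f df -> is_derive x v (fun y => a * f y) (a * df).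
Proof.
exact: (@is_derive_linear R V (clifford R n) (clifford R n) (fun b => a * b)
  _ _ _ _ (mull_linear a) (@mull_continuous a)).
Qed.

Lemma is_derive_clcoord S (x v : V) (f : V -> clifford R n) df :
  is_derive x v f df -> is_derive x v (fun y => clcoord (f y) S) (clcoord df S).
Proof.
exact: (@is_derive_linear R V (clifford R n) R (fun b => clcoord b S)
  _ _ _ _ (clcoord_linear S) (@clcoord_continuous S)).
Qed.

Lemma is_derive_mul (x v : V) (f g : V -> clifford R n) df dg :
  is_derive x v f df -> is_derive x v g dg ->
  is_derive x v (fun y => f y * g y) (f x * dg + df * g x).
Proof.
move=> fv gv.
rewrite (_ : (fun y => _) = fun y => \sum_(S : {set 'I_n})
   clcoord (f y) S *: (blade R S * g y)); last first.
  by apply/funext => y; rewrite clifford_mulE.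
rewrite (clifford_mulE (f x)) (clifford_mulE df) -big_split /=.
apply: is_derive_bigsum => S.
exact: is_derive_scale (is_derive_clcoord S fv) (is_derive_mull (blade R S) gv).
Qed.

(** Coordinates are continuous linear forms, hence commute with derivatives; the
claim is [derive_comm] for each of them. *)
Lemma class_C_derive_comm (E U : set V) (f : V -> clifford R n) v w p :
  open U -> class_C E 2 U f -> E v -> E w -> U p ->
  'D_w ('D_v f) p = 'D_v ('D_w f) p.
Proof.
move=> oU Cf Ev Ew Up; apply: clcoordP => S.
have fS (h : V -> clifford R n) u k q : class_C E k.+1 U h -> E u -> U q ->
    'D_u (fun y => clcoord (h y) S) q = clcoord ('D_u h q) S.
  by move=> Ch Eu Uq; case: (is_derive_clcoord S (class_C_is_derive Ch Eu Uq)).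
have fSS u1 u2 q : E u1 -> E u2 -> U q ->
    'D_u2 ('D_u1 (fun y => clcoord (f y) S)) q = clcoord ('D_u2 ('D_u1 f) q) S.
  move=> E1 E2 Uq; rewrite -(fS _ _ 0) //; last exact: class_C_derive Cf E1.
  apply: near_eq_derive; apply: (near_open_eq oU) Uq => y Uy.
  exact: (fS _ _ 1).
apply: (etrans (esym (fSS v w p Ev Ew Up))).
apply: (etrans _ (fSS w v p Ew Ev Up)).
have CfS : class_C E 2 U (fun y => clcoord (f y) S).
  exact: (class_C_linear oU (clcoord_linear S) (@clcoord_continuous S) Cf).
have C1 u : E u -> class_C E 1 U ('D_u (fun y => clcoord (f y) S)).
  exact: class_C_derive.
apply: derive_comm.
- apply: filterS (open_nbhs_nbhs (conj oU Up)) => q Uq; split.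
  + exact: class_C_derivable CfS Ev Uq.
  + exact: class_C_derivable CfS Ew Uq.
  + exact: class_C_derivable (C1 v Ev) Ew Uq.
  + exact: class_C_derivable (C1 w Ew) Ev Uq.
- exact: class_C_continuous (class_C_derive (C1 v Ev) Ew) Up.
- exact: class_C_continuous (class_C_derive (C1 w Ew) Ev) Up.
Qed.

End CliffordCalculus.

(** * The half-plane coordinates of a paravector *)

Section Dirac.
Context {R : realType} {n : nat}.
Local Notation pv := 'rV[R]_n.+1.
Implicit Types (x v : pv).

Local Notation xi x i := ((x : pv) 0 (lift ord0 i)).
Local Notation e_ i := (clgen R (i : 'I_n)).
Definition pv_halfplane x : R * R := (pv_scal x, pv_rad x).

Lemma sum_clgen_sqr : \sum_(i < n) e_ i * e_ i = - n%:R :> clifford R n.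
Proof.
under eq_bigr do rewrite -expr2 clgen_sqr.
by rewrite sumr_const card_ord mulNrn.
Qed.

Lemma pv_rad_sqr x : pv_rad x ^+ 2 = \sum_(i < n) xi x i ^+ 2.
Proof. by rewrite sqr_sqrtr // sumr_ge0 // => i _; rewrite sqr_ge0. Qed.

(** In the double sum for the square, added to its transpose, anticommutation
cancels all terms off the diagonal. *)
Lemma pv_vect_sqr x : pv_vect x * pv_vect x = - pv_rad x ^+ 2 *: 1.
Proof.
have anti (i j : 'I_n) : e_ i * e_ j + e_ j * e_ i = (- (i == j)%:R * 2) *: 1.
  case: (eqVneq i j) => [->|ij].
    by rewrite -expr2 clgen_sqr -mulr2n mulN1r scaleNr scaler_nat mulNrn.
  by rewrite (clgen_anticomm R ij) addNr oppr0 mul0r scale0r.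
set v := pv_vect x.
have vE : v * v = \sum_(i < n) \sum_(j < n) (xi x i * xi x j) *: (e_ i * e_ j).
  rewrite mulr_suml; apply: eq_bigr => i _; rewrite mulr_sumr.
  by apply: eq_bigr => j _; rewrite -scalerAl -scalerAr scalerA.
have v2 : 2 *: (v * v) = 2 *: (- pv_rad x ^+ 2 *: 1).
  rewrite scaler_nat mulr2n vE [X in X + _]exchange_big -big_split /= scalerA.
  rewrite pv_rad_sqr mulrN mulr_sumr -sumrN scaler_suml; apply: eq_bigr => i _.
  rewrite -big_split /= (bigD1 i) //= big1 => [|j ji].
    by rewrite addr0 -scalerDr anti eqxx mulr1n scalerA; congr (_ *: _); ring.
  rewrite [xi x j * _]mulrC -scalerDr anti.
  by rewrite ?[i == j]eq_sym (negbTE ji) oppr0 mul0r scale0r scaler0.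
by apply: (scalerI _ v2); rewrite pnatr_eq0.
Qed.

Lemma is_derive_coord m (x v : 'rV[R]_m) k :
  is_derive x v (fun y : 'rV[R]_m => y 0 k) (v 0 k).
Proof.
have cl : linear (fun y : 'rV[R]_m => y 0 k) by move=> a u w; rewrite !mxE.
exact: (is_derive_linear cl (@coord_continuous R 1 m 0 k) (is_derive_id x v)).
Qed.

Lemma is_derive_pv_vect x v : is_derive x v (@pv_vect R n) (pv_vect v).
Proof.
apply: is_derive_bigsum => i.
have := is_derive_scale (is_derive_coord x v (lift ord0 i)) (is_derive_cst (e_ i) x v).
by rewrite scaler0 add0r.
Qed.

Lemma is_derive_pv_rad x v : 0 < pv_rad x ->
  is_derive x v (@pv_rad R n) ((pv_rad x)^-1 * \sum_(i < n) xi x i * xi v i).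
Proof.
move=> r0.
have s0 : 0 < \sum_(i < n) xi x i ^+ 2 by rewrite -pv_rad_sqr exprn_gt0.
have ds : is_derive x v (fun y : pv => \sum_(i < n) xi y i ^+ 2)
    (\sum_(i < n) (xi x i * xi v i + xi v i * xi x i)).
  apply: is_derive_bigsum => i.
  exact: is_derive_scale (is_derive_coord x v _) (is_derive_coord x v _).
have := is_derive_comp1 ds (is_derive1_sqrt s0).
set S := \sum_(i < n) xi x i * xi v i.
have -> : \sum_(i < n) (xi x i * xi v i + xi v i * xi x i) = 2 * S.
  by rewrite mulr_sumr; apply: eq_bigr => i _; ring.
rewrite -/(pv_rad x) (_ : _ *: _ = (pv_rad x)^-1 * S) //.
by rewrite [LHS]mulrC; field; rewrite gt_eqF.
Qed.

Lemma pv_scal_continuous : continuous (@pv_scal R n).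
Proof. exact: coord_continuous. Qed.

Lemma pv_rad_continuous : continuous (@pv_rad R n).
Proof.
move=> x; apply: (continuous_comp _ (@sqrt_continuous R _)).
apply: continuous_big => [|i _ y]; first exact: add_continuous.
exact: (continuous_comp (@coord_continuous R 1 n.+1 0 _ y) (@exprn_continuous _ _ _)).
Qed.

Lemma open_Omega (D : set (R * R)) : open D -> open (@Omega R n D).
Proof.
move=> oD; apply: (@open_comp _ _ pv_halfplane D _ oD) => x _.
exact: cvg_pair (@pv_scal_continuous x) (@pv_rad_continuous x).
Qed.

Context {W : normedModType R}.

Lemma is_derive_halfplane0 (F : R * R -> W) x dF :
  is_derive (pv_halfplane x) (1, 0) F dF ->
  is_derive x (delta_mx 0 ord0) (F \o pv_halfplane) dF.
Proof.
move=> /is_derive_line0 Fx; apply/is_derive_line0.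
rewrite (_ : (fun h => _) = fun h : R => F (h *: (1, 0) + pv_halfplane x)) //.
apply/funext => h /=; congr (F (_, _)).
  by rewrite /pv_scal !mxE !eqxx.
rewrite /= [_ *: 0]mulr0 add0r /pv_rad; congr (Num.sqrt _); apply: eq_bigr => i _.
by rewrite !mxE andbC eq_sym (negbTE (neq_lift _ _)) mulr0 add0r.
Qed.

(** Along a vector of the basis other than the first one, x_0 is constant, and F is
seen as a function of the radius only. *)
Lemma is_derive_halfplane1 (F : R * R -> W) x dF (j : 'I_n) :
  0 < pv_rad x -> is_derive (pv_halfplane x) (0, 1) F dF ->
  is_derive x (delta_mx 0 (lift ord0 j)) (F \o pv_halfplane)
    ((xi x j / pv_rad x) *: dF).
Proof.
move=> r0 Fx; apply/is_derive_line0.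
set d := delta_mx 0 (lift ord0 j).
pose G (t : R) : W := F (t *: (0, 1) + (pv_scal x, 0)).
have dG : is_derive (pv_rad x) 1 G dF.
  apply: (@is_derive_line R (R * R)%type W (pv_scal x, 0) (0, 1) (pv_rad x) F dF).1.
  have -> : pv_rad x *: (0, 1) + (pv_scal x, 0) = pv_halfplane x :> R * R.
    by congr (_, _); rewrite /= ?[_ *: 0]mulr0 ?[_ *: 1]mulr1 ?addr0 ?add0r.
  exact: Fx.
have drad : is_derive (0 : R) 1 (fun h : R => pv_rad (h *: d + x)) (xi x j / pv_rad x).
  apply: (is_derive_line0 _ _ _ _).1.
  have := is_derive_pv_rad d r0.
  rewrite (bigD1 j) //= big1 ?addr0 => [|i ij].
    by rewrite mxE !eqxx mulr1 mulrC; apply.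
  by rewrite /d mxE (inj_eq lift_inj) (negbTE ij) mulr0.
rewrite (_ : (fun h => _) = G \o (fun h : R => pv_rad (h *: d + x))).
  by apply: (is_derive_comp1 drad); rewrite scale0r add0r; exact: dG.
apply/funext => h /=; congr (F (_, _)).
  by rewrite /= [_ *: 0]mulr0 add0r /pv_scal /d !mxE (negbTE (neq_lift _ _)) mulr0 add0r.
by rewrite /= [_ *: 1]mulr1 addr0.
Qed.

End Dirac.

(** * The Dirac operator on axial functions *)

Section DiracAxial.
Context {R : realType} {n : nat}.
Local Notation W := (clifford R n).
Implicit Types (A B : R * R -> W) (x : 'rV[R]_n.+1) (p : R * R).

Lemma clcoordN (a : W) S : clcoord (- a) S = - clcoord a S.
Proof. by rewrite -scaleN1r clcoordZ mulN1r. Qed.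

(** The components of the Dirac operator applied to an axial function with
components A and B, as shown by [dirac_axial]. *)
Definition axial_dirac_scal A B p : W :=
  dx0 A p - dr B p - ((n%:R - 1) / p.2) *: B p.

Definition axial_dirac_vect A B p : W := dx0 B p + dr A p.

(** The derivative of [f] along the j-th vector direction is
[x_j X + e_j Y] with X and Y independent of j. Summing after multiplication by
[e_j] on the left gives [v X - n Y], where v is the vector part, and
[v * v = - r ^ 2] turns the terms of X that contain v into terms without it. *)
Lemma dirac_axial (D : set (R * R)) (f : 'rV[R]_n.+1 -> W) A B :
  open D -> (forall p, D p -> 0 < p.2) ->
  class_C (plane_basis R) 1 D A -> class_C (plane_basis R) 1 D B ->
  axial_components D f A B ->
  axial_components D (Defs.dirac f) (axial_dirac_scal A B) (axial_dirac_vect A B).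
Proof.
move=> oD D0 CA CB fE x Dx.
have r0 : 0 < pv_rad x by exact: D0 Dx.
have rn0 : pv_rad x != 0 by rewrite gt_eqF.
set p := pv_halfplane x; set r := pv_rad x in r0 rn0 *; set v := pv_vect x.
have bas0 : plane_basis R (1, 0) by left.
have bas1 : plane_basis R (0, 1) by right.
have df d rho a b : is_derive x d (@pv_rad R n) rho ->
    is_derive x d (A \o pv_halfplane) a -> is_derive x d (B \o pv_halfplane) b ->
    'D_d f x = a + (r^-1 *: (v * b + pv_vect d * B p)
                    + (- (rho / r ^+ 2)) *: (v * B p)).
  move=> drho da db.
  have drV : is_derive x d (fun y : 'rV[R]_n.+1 => (pv_rad y)^-1) (- (rho / r ^+ 2)).
    have := is_derive_comp1 drho (@is_deriveV R id r 1 1 rn0 (is_derive_id r 1)).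
    by rewrite (_ : rho *: _ = - (rho / r ^+ 2)) // [_ *: 1]mulr1 [LHS]mulrN.
  have fv := is_deriveD da (is_derive_scale drV
    (is_derive_mul (is_derive_pv_vect x d) db)).
  suff near_f : \near x, ((A \o pv_halfplane) + (fun y => (pv_rad y)^-1 *:
      (pv_vect y * (B \o pv_halfplane) y))) x = f x.
    by case: (near_eq_is_derive near_f fv).
  apply: (near_open_eq (open_Omega oD)) Dx => y Dy.
  by rewrite fE // /pv_omega -scalerAl.
have f0 : 'D_(delta_mx 0 ord0) f x = dx0 A p + r^-1 *: (v * dx0 B p).
  have dr0 := is_derive_pv_rad (delta_mx 0 ord0) r0.
  rewrite (df _ _ _ _ dr0 (is_derive_halfplane0 (class_C_is_derive CA bas0 Dx))
    (is_derive_halfplane0 (class_C_is_derive CB bas0 Dx))).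
  rewrite big1 => [|i _]; last by rewrite mxE andbC eq_sym (negbTE (neq_lift _ _)) mulr0.
  rewrite mulr0 mul0r oppr0 scale0r addr0 /pv_vect big1 ?mul0r ?addr0 // => i _.
  by rewrite mxE andbC eq_sym (negbTE (neq_lift _ _)) scale0r.
have f1 (j : 'I_n) : 'D_(delta_mx 0 (lift ord0 j)) f x =
    (x 0 (lift ord0 j)) *: (r^-1 *: dr A p + (r^-1 ^+ 2) *: (v * dr B p)
       - (r^-1 ^+ 3) *: (v * B p)) + clgen R j * (r^-1 *: B p).
  have drj := is_derive_pv_rad (delta_mx 0 (lift ord0 j)) r0.
  rewrite (df _ _ _ _ drj (is_derive_halfplane1 j r0 (class_C_is_derive CA bas1 Dx))
    (is_derive_halfplane1 j r0 (class_C_is_derive CB bas1 Dx))).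
  rewrite (bigD1 j) //= big1 => [|i ij]; last first.
    by rewrite mxE (inj_eq lift_inj) (negbTE ij) mulr0.
  have -> : pv_vect (delta_mx 0 (lift ord0 j)) = clgen R j.
    rewrite /pv_vect (bigD1 j) //= big1 => [|i ij].
      by rewrite mxE !eqxx scale1r addr0.
    by rewrite mxE (inj_eq lift_inj) (negbTE ij) scale0r.
  rewrite mxE !eqxx mulr1 addr0 -!scalerAr -/r -/p.
  apply: clcoordP => S; rewrite !(clcoordD, clcoordN, clcoordZ).
  by field.
rewrite /Defs.dirac f0; under eq_bigr do rewrite f1 mulrDr -scalerAr scalerAl mulrA.
rewrite big_split /= -!mulr_suml sum_clgen_sqr -/(pv_vect x) -/v.
rewrite !mulrBr !mulrDr -!scalerAr !mulrA pv_vect_sqr -/r -!scalerAl !mul1r.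
rewrite /axial_dirac_scal /axial_dirac_vect -/p /pv_omega -/r -/v.
have pE : (pv_scal x, r) = p by [].
have p2 : p.2 = r by [].
rewrite mulNr mulr_natl -scaler_nat pE p2.
(* Both sides are combinations of the same five Clifford numbers. *)
move: (v * dx0 B p) (v * dr A p) (dx0 A p) (dr B p) (B p) => vB0 vAr A0 Br Bp.
clear -rn0; clearbody r; apply: clcoordP => S.
by rewrite !clcoordD !clcoordN !clcoordZ clcoordN clcoordZ; field.
Qed.

End DiracAxial.

(** * Recovering the components of an axial function *)

Section AxialComponents.
Context {R : realType} {n : nat}.
Local Notation W := (clifford R n.+1).
Implicit Types (A B : R * R -> W) (p : R * R) (s : R).

Let e0 : W := clgen R ord0.

(** For s = 1 and s = -1, the two points above p whose vector part is on the line
of the first generator. *)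
Definition halfplane_lift s p : 'rV[R]_n.+2 :=
  p.1 *: delta_mx 0 ord0 + (s * p.2) *: delta_mx 0 (lift ord0 ord0).

Lemma pv_scal_lift s p : pv_scal (halfplane_lift s p) = p.1.
Proof. by rewrite /pv_scal !mxE !eqxx /= mulr1 mulr0 addr0. Qed.

Lemma halfplane_lift_vect s p (i : 'I_n.+1) :
  halfplane_lift s p 0 (lift ord0 i) = (i == ord0)%:R * (s * p.2).
Proof.
by rewrite !mxE (inj_eq lift_inj) /= mulr0 add0r mulrC.
Qed.

Lemma pv_vect_lift s p : pv_vect (halfplane_lift s p) = (s * p.2) *: e0.
Proof.
rewrite /pv_vect (bigD1 ord0) //= big1 ?addr0 => [|i /negbTE i0].
  by rewrite halfplane_lift_vect mul1r.
by rewrite halfplane_lift_vect i0 mul0r scale0r.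
Qed.

Lemma pv_rad_lift s p : s ^+ 2 = 1 -> 0 < p.2 ->
  pv_rad (halfplane_lift s p) = p.2.
Proof.
move=> s1 p0; rewrite /pv_rad (bigD1 ord0) //= big1 ?addr0 => [|i /negbTE i0].
  by rewrite halfplane_lift_vect mul1r exprMn s1 mul1r sqrtr_sqr gtr0_norm.
by rewrite halfplane_lift_vect i0 mul0r expr0n.
Qed.

Lemma pv_omega_lift s p : s ^+ 2 = 1 -> 0 < p.2 ->
  pv_omega (halfplane_lift s p) = s *: e0.
Proof.
move=> s1 p0; rewrite /pv_omega pv_rad_lift // pv_vect_lift scalerA.
by rewrite mulrCA mulVf ?mulr1 // gt_eqF.
Qed.

Context (D : set (R * R)).
Hypotheses (oD : open D) (D0 : forall p, D p -> 0 < p.2).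

Lemma Omega_lift s p : s ^+ 2 = 1 -> D p -> Omega D (halfplane_lift s p).
Proof.
move=> s1 Dp; rewrite /Omega /= pv_scal_lift pv_rad_lift //; last exact: D0.
by rewrite -surjective_pairing.
Qed.

(** At these points omega is s times the first generator, a constant: the values
of f there are combinations of the two components with constant coefficients. *)
Lemma axial_components_lift (f : 'rV[R]_n.+2 -> W) A B s p :
  axial_components D f A B -> s ^+ 2 = 1 -> D p ->
  f (halfplane_lift s p) = A p + s *: (e0 * B p).
Proof.
move=> fE s1 Dp; have p0 := D0 Dp; rewrite fE; last exact: Omega_lift.
rewrite pv_scal_lift pv_rad_lift // pv_omega_lift // -surjective_pairing.
by rewrite scalerAl.
Qed.

Lemma axial_scalE (f : 'rV[R]_n.+2 -> W) A B p :
  axial_components D f A B -> D p ->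
  A p = 2^-1 *: (f (halfplane_lift 1 p) + f (halfplane_lift (-1) p)).
Proof.
move=> fE Dp; rewrite !(axial_components_lift fE) ?sqrrN ?expr1n //.
rewrite scaleN1r scale1r addrACA subrr addr0 -mulr2n -[A p *+ 2]scaler_nat scalerA.
by rewrite mulVf ?scale1r // pnatr_eq0.
Qed.

Lemma axial_vectE (f : 'rV[R]_n.+2 -> W) A B p :
  axial_components D f A B -> D p ->
  B p = - 2^-1 *: (e0 * (f (halfplane_lift 1 p) - f (halfplane_lift (-1) p))).
Proof.
move=> fE Dp; rewrite !(axial_components_lift fE) ?sqrrN ?expr1n //.
rewrite scaleN1r scale1r opprD opprK addrACA subrr add0r -mulr2n -[_ * _ *+ 2]scaler_nat.
rewrite -scalerAr mulrA -expr2 clgen_sqr mulN1r !scalerN scalerA.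
by rewrite mulNr mulVf ?scaleNr ?scale1r ?opprK // pnatr_eq0.
Qed.

Lemma axial_components_eq0 (f : 'rV[R]_n.+2 -> W) A B p :
  axial_components D f A B -> (forall x, Omega D x -> f x = 0) -> D p ->
  A p = 0 /\ B p = 0.
Proof.
move=> fE f0 Dp; rewrite (axial_scalE fE Dp) (axial_vectE fE Dp).
rewrite !f0; try by apply: Omega_lift => //; rewrite ?sqrrN expr1n.
by rewrite subr0 mulr0 addr0 !scaler0.
Qed.

Lemma halfplane_lift_linear s : linear (halfplane_lift s).
Proof.
move=> a p q; apply/rowP => i; rewrite !mxE.
by rewrite -[(a *: p + q).1]/(a * p.1 + q.1) -[(a *: p + q).2]/(a * p.2 + q.2); ring.
Qed.

Lemma halfplane_lift_continuous s : continuous (halfplane_lift s).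
Proof.
move=> p; apply: cvgD; apply: cvgZr_tmp; first exact: cvg_fst.
by apply: cvgM; [exact: cvg_cst|exact: cvg_snd].
Qed.

Lemma class_C_lift (f : 'rV[R]_n.+2 -> W) k s :
  s ^+ 2 = 1 -> class_C (@pv_basis R n.+1) k (Omega D) f ->
  class_C (plane_basis R) k D (fun p => f (halfplane_lift s p)).
Proof.
move=> s1; apply: class_C_comp_linear => //.
- exact: halfplane_lift_linear.
- exact: halfplane_lift_continuous.
- by move=> p; exact: Omega_lift.
- move=> v [->|->].
  + exists 1, (delta_mx 0 ord0); split; first by exists ord0.
    by rewrite /halfplane_lift /= mulr0 scale0r addr0.
  + exists s, (delta_mx 0 (lift ord0 ord0)); split; first by exists (lift ord0 ord0).
    by rewrite /halfplane_lift /= mulr1 scale0r add0r.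
Qed.

Lemma class_C_axial (f : 'rV[R]_n.+2 -> W) A B k :
  class_C (@pv_basis R n.+1) k (Omega D) f -> axial_components D f A B ->
  class_C (plane_basis R) k D A /\ class_C (plane_basis R) k D B.
Proof.
move=> Cf fE.
have Cp := class_C_lift (expr1n R 2) Cf.
have Cm : class_C (plane_basis R) k D (fun p => f (halfplane_lift (-1) p)).
  by apply: class_C_lift Cf; rewrite sqrrN expr1n.
split.
  apply: class_C_ext (class_CZ oD 2^-1 (class_CD oD Cp Cm)) => // p Dp.
  by rewrite -(axial_scalE fE Dp).
have CL := class_C_linear oD (@mull_linear R n.+1 e0) (@mull_continuous R n.+1 e0)
  (class_CB oD Cp Cm).
apply: class_C_ext (class_CZ oD (- 2^-1) CL) => // p Dp.
by rewrite -(axial_vectE fE Dp).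
Qed.

End AxialComponents.

(** * Iterates of the axial Dirac operator *)

Lemma is_derive_val (R : realType) (V W : normedModType R) (f : V -> W) x v df :
  is_derive x v f df -> 'D_v f x = df.
Proof. by case. Qed.

Ltac clifford_field := intros; apply: clcoordP => ?;
  rewrite !(clcoordD, clcoordN, clcoordZ); field.

Section AxialDiracIterates.
Context {R : realType} {n : nat}.
Local Notation W := (clifford R n).
Implicit Types (A B F : R * R -> W) (p : R * R).
Let e1 : R * R := (1, 0).
Let e2 : R * R := (0, 1).
Let c : R := n%:R - 1.

Lemma plane_basis1 : plane_basis R e1. Proof. by left. Qed.
Lemma plane_basis2 : plane_basis R e2. Proof. by right. Qed.

(** The Leibniz rule for division by r. Division by a higher power of r is
handled by iterating it. *)
Lemma is_derive_div_snd (a : R) F p v dF : p.2 != 0 -> is_derive p v F dF ->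
  is_derive p v (fun q => (a / q.2) *: F q)
    ((a / p.2) *: dF - (a * v.2 / p.2 ^+ 2) *: F p).
Proof.
move=> p0 Fp.
have d2 : is_derive p v snd v.2.
  have l2 : linear (@snd R R) by [].
  by apply: (is_derive_linear l2 _ (is_derive_id p v)) => q; exact: cvg_snd.
have dV : is_derive p v (fun q => a / q.2) (- (a * v.2 / p.2 ^+ 2)).
  have /(is_derive_comp1 d2) := is_derive_scale (is_derive_cst a p.2 1)
    (@is_deriveV R id p.2 1 1 p0 (is_derive_id p.2 1)).
  rewrite (_ : _ *: (_ + _) = - (a * v.2 / p.2 ^+ 2)) //.
  rewrite -[LHS]/(v.2 * (a * (- p.2 ^- 2 * 1) + 0 * (p.2)^-1)).
  by field.
have := is_derive_scale dV Fp.
by rewrite scaleNr.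
Qed.

Context (D : set (R * R)).
Hypotheses (oD : open D) (D0 : forall p, D p -> 0 < p.2).
Local Notation CC k F := (class_C (plane_basis R) k D F).

Lemma snd_neq0 p : D p -> p.2 != 0.
Proof. by move=> Dp; rewrite gt_eqF // D0. Qed.

Lemma class_C_div_snd (a : R) k F : CC k F -> CC k (fun p => (a / p.2) *: F p).
Proof.
have cdiv (F' : R * R -> W) b p : {for p, continuous F'} -> D p ->
    {for p, continuous (fun p => (b / p.2) *: F' p)}.
  move=> cF Dp; apply: cvgZ cF; apply: cvgM; first exact: cvg_cst.
  by apply: cvgV; [exact: snd_neq0|exact: cvg_snd].
elim: k a F => [|k ih] a F CF.
  by split=> // p; rewrite inE => Dp; exact: cdiv (class_C_continuous CF Dp) Dp.
apply: (class_CI oD) => [p Dp|v vE].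
  exact: cdiv (class_C_continuous CF Dp) Dp.
exists (fun p => (a / p.2) *: 'D_v F p - (v.2 / p.2) *: ((a / p.2) *: F p)).
  move=> p Dp; have p0 := snd_neq0 Dp.
  have := is_derive_div_snd a p0 (class_C_is_derive CF vE Dp).
  rewrite (_ : a * v.2 / p.2 ^+ 2 = v.2 / p.2 * (a / p.2)); last by field.
  by rewrite -[(v.2 / p.2 * _) *: F p]scalerA.
apply: (class_CB oD); first exact: ih (class_C_derive CF vE).
by apply: (ih v.2); apply: ih; exact: class_CW.
Qed.

Lemma is_derive_dx0 k F p : CC k.+1 F -> D p -> is_derive p e1 F (dx0 F p).
Proof. by move=> CF Dp; exact: class_C_is_derive CF plane_basis1 Dp. Qed.

Lemma is_derive_dr k F p : CC k.+1 F -> D p -> is_derive p e2 F (dr F p).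
Proof. by move=> CF Dp; exact: class_C_is_derive CF plane_basis2 Dp. Qed.

Lemma class_C_dx0 k F : CC k.+1 F -> CC k (dx0 F).
Proof. by move=> CF; exact: class_C_derive CF plane_basis1. Qed.

Lemma class_C_dr k F : CC k.+1 F -> CC k (dr F).
Proof. by move=> CF; exact: class_C_derive CF plane_basis2. Qed.

Lemma class_C_axial_dirac k A B : CC k.+1 A -> CC k.+1 B ->
  CC k (axial_dirac_scal A B) /\ CC k (axial_dirac_vect A B).
Proof.
move=> CA CB; split.
  apply: (class_CB oD); last exact: class_C_div_snd (class_CW CB).
  exact: (class_CB oD (class_C_dx0 CA) (class_C_dr CB)).
exact: (class_CD oD (class_C_dx0 CB) (class_C_dr CA)).
Qed.

(** Mixed derivatives are put in the form with the derivatives in x_0 outermost. *)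
Lemma is_derive_dr_dx0 F p : CC 2 F -> D p ->
  is_derive p e2 (dx0 F) (dx0 (dr F) p).
Proof.
move=> CF Dp.
have -> : dx0 (dr F) p = dr (dx0 F) p.
  exact: class_C_derive_comm oD CF plane_basis2 plane_basis1 Dp.
exact: is_derive_dr (class_C_dx0 CF) Dp.
Qed.

Lemma is_derive_dr_dx0_dx0 F p : CC 3 F -> D p ->
  is_derive p e2 (dx0 (dx0 F)) (dx0 (dx0 (dr F)) p).
Proof.
move=> CF Dp.
have <- : dx0 (dr (dx0 F)) p = dx0 (dx0 (dr F)) p.
  apply: near_eq_derive; apply: (near_open_eq oD) Dp => q Dq.
  by case: (is_derive_dr_dx0 (class_CW CF) Dq).
exact: is_derive_dr_dx0 (class_C_dx0 CF) Dp.
Qed.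

(** Derivatives of the iterates are computed from closed forms that hold on D only,
which is enough because D is open. *)
Lemma near_is_derive F G p v dF : (forall q, D q -> G q = F q) -> D p ->
  is_derive p v F dF -> 'D_v G p = dF.
Proof.
move=> GF Dp [_ <-]; apply: near_eq_derive; exact: (near_open_eq oD) Dp.
Qed.

(** The expansion of the second iterate; the cross derivatives that come from the
two components merge because mixed derivatives are symmetric. *)
Lemma axial_dirac2 A B p : CC 2 A -> CC 2 B -> D p ->
  axial_dirac_scal (axial_dirac_scal A B) (axial_dirac_vect A B) p =
    dx0 (dx0 A) p - dr (dr A) p - 2 *: dx0 (dr B) p
    - (2 * c / p.2) *: dx0 B p - (c / p.2) *: dr A p /\
  axial_dirac_vect (axial_dirac_scal A B) (axial_dirac_vect A B) p =
    dx0 (dx0 B) p - dr (dr B) p + 2 *: dx0 (dr A) p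
    - (c / p.2) *: dr B p + (c / p.2 ^+ 2) *: B p.
Proof.
move=> CA CB Dp; have p0 := snd_neq0 Dp.
have C1A := class_CW CA; have C1B := class_CW CB.
set S := axial_dirac_scal A B; set V := axial_dirac_vect A B.
have dS : dx0 S p = _ := is_derive_val (is_deriveB
  (is_deriveB (is_derive_dx0 (class_C_dx0 CA) Dp) (is_derive_dx0 (class_C_dr CB) Dp))
  (is_derive_div_snd c p0 (is_derive_dx0 C1B Dp))).
have rS : dr S p = _ := is_derive_val (is_deriveB
  (is_deriveB (is_derive_dr_dx0 CA Dp) (is_derive_dr (class_C_dr CB) Dp))
  (is_derive_div_snd c p0 (is_derive_dr C1B Dp))).
have dV : dx0 V p = _ := is_derive_val (is_deriveD
  (is_derive_dx0 (class_C_dx0 CB) Dp) (is_derive_dx0 (class_C_dr CA) Dp)).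
have rV : dr V p = _ := is_derive_val (is_deriveD
  (is_derive_dr_dx0 CB Dp) (is_derive_dr (class_C_dr CA) Dp)).
split.
- rewrite -[LHS]/(dx0 S p - dr V p - (c / p.2) *: (dx0 B p + dr A p)).
  rewrite dS rV -[e1.2]/(0 : R); clear -p0.
  generalize (dx0 (dx0 A) p), (dx0 (dr B) p), (dr (dr A) p), (dx0 B p), (dr A p), (B p).
  by clifford_field.
- rewrite -[LHS]/(dx0 V p + dr S p).
  rewrite dV rS -[e2.2]/(1 : R); clear -p0.
  generalize (dx0 (dx0 B) p), (dx0 (dr A) p), (dr (dr B) p), (dr B p), (B p).
  by clifford_field.
Qed.

Lemma axial_dirac3 A B p : CC 3 A -> CC 3 B -> D p ->
  let A2 := axial_dirac_scal (axial_dirac_scal A B) (axial_dirac_vect A B) in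
  let B2 := axial_dirac_vect (axial_dirac_scal A B) (axial_dirac_vect A B) in
  axial_dirac_scal A2 B2 p =
    dx0 (dx0 (dx0 A)) p + dr (dr (dr B)) p
    - 3 *: dx0 (dx0 (dr B)) p - 3 *: dx0 (dr (dr A)) p
    - (3 * c / p.2) *: dx0 (dx0 B) p - (3 * c / p.2) *: dx0 (dr A) p
    + (2 * c / p.2) *: dr (dr B) p + (c * (c - 2) / p.2 ^+ 2) *: dr B p
    - (c * (c - 2) / p.2 ^+ 3) *: B p /\
  axial_dirac_vect A2 B2 p =
    dx0 (dx0 (dx0 B)) p - dr (dr (dr A)) p
    + 3 *: dx0 (dx0 (dr A)) p - 3 *: dx0 (dr (dr B)) p
    - (3 * c / p.2) *: dx0 (dr B) p + (3 * c / p.2 ^+ 2) *: dx0 B p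
    - (c / p.2) *: dr (dr A) p + (c / p.2 ^+ 2) *: dr A p.
Proof.
move=> CA CB Dp A2 B2; have p0 := snd_neq0 Dp.
have C2A := class_CW CA; have C2B := class_CW CB.
have C1A := class_CW C2A; have C1B := class_CW C2B.
pose F q := dx0 (dx0 A) q - dr (dr A) q - 2 *: dx0 (dr B) q
  - (2 * c / q.2) *: dx0 B q - (c / q.2) *: dr A q.
(* In G, the quotient of B by the square of r is written as two divisions by r,
   the form to which is_derive_div_snd applies. *)
pose G q := dx0 (dx0 B) q - dr (dr B) q + 2 *: dx0 (dr A) q
  - (c / q.2) *: dr B q + (c / q.2) *: ((1 / q.2) *: B q).
have A2F q : D q -> A2 q = F q by move=> Dq; exact: (axial_dirac2 C2A C2B Dq).1.
have B2G q : D q -> B2 q = G q.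
  move=> Dq; apply: (etrans (axial_dirac2 C2A C2B Dq).2).
  rewrite /G [(c / q.2) *: (_ *: _)]scalerA; congr (_ + _ *: _).
  by rewrite mulrA mulr1 expr2 invfM mulrA.
have dA2 : dx0 A2 p = _ := near_is_derive A2F Dp
  (is_deriveB (is_deriveB (is_deriveB (is_deriveB
  (is_derive_dx0 (class_C_dx0 (class_C_dx0 CA)) Dp)
  (is_derive_dx0 (class_C_dr (class_C_dr CA)) Dp))
  (is_deriveZ 2 (is_derive_dx0 (class_C_dx0 (class_C_dr CB)) Dp)))
  (is_derive_div_snd (2 * c) p0 (is_derive_dx0 (class_C_dx0 C2B) Dp)))
  (is_derive_div_snd c p0 (is_derive_dx0 (class_C_dr C2A) Dp))).
have rA2 : dr A2 p = _ := near_is_derive A2F Dp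
  (is_deriveB (is_deriveB (is_deriveB (is_deriveB
  (is_derive_dr_dx0_dx0 CA Dp)
  (is_derive_dr (class_C_dr (class_C_dr CA)) Dp))
  (is_deriveZ 2 (is_derive_dr_dx0 (class_C_dr CB) Dp)))
  (is_derive_div_snd (2 * c) p0 (is_derive_dr_dx0 C2B Dp)))
  (is_derive_div_snd c p0 (is_derive_dr (class_C_dr C2A) Dp))).
have dB2 : dx0 B2 p = _ := near_is_derive B2G Dp
  (is_deriveD (is_deriveB (is_deriveD (is_deriveB
  (is_derive_dx0 (class_C_dx0 (class_C_dx0 CB)) Dp)
  (is_derive_dx0 (class_C_dr (class_C_dr CB)) Dp))
  (is_deriveZ 2 (is_derive_dx0 (class_C_dx0 (class_C_dr CA)) Dp)))
  (is_derive_div_snd c p0 (is_derive_dx0 (class_C_dr C2B) Dp)))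
  (is_derive_div_snd c p0 (is_derive_div_snd 1 p0 (is_derive_dx0 C1B Dp)))).
have rB2 : dr B2 p = _ := near_is_derive B2G Dp
  (is_deriveD (is_deriveB (is_deriveD (is_deriveB
  (is_derive_dr_dx0_dx0 CB Dp)
  (is_derive_dr (class_C_dr (class_C_dr CB)) Dp))
  (is_deriveZ 2 (is_derive_dr_dx0 (class_C_dr CA) Dp)))
  (is_derive_div_snd c p0 (is_derive_dr (class_C_dr C2B) Dp)))
  (is_derive_div_snd c p0 (is_derive_div_snd 1 p0 (is_derive_dr C1B Dp)))).
split.
- rewrite -[LHS]/(dx0 A2 p - dr B2 p - (c / p.2) *: B2 p) dA2 rB2 (B2G p Dp) /G.
  rewrite -[e1.2]/(0 : R) -[e2.2]/(1 : R); clear -p0.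
  generalize (dx0 (dx0 (dx0 A)) p), (dx0 (dr (dr A)) p), (dx0 (dx0 (dr B)) p),
    (dr (dr (dr B)) p),
    (dx0 (dx0 B) p), (dx0 (dr A) p), (dr (dr B) p), (dr B p), (B p), (dx0 B p), (dr A p).
  by clifford_field.
- rewrite -[LHS]/(dx0 B2 p + dr A2 p) dB2 rA2.
  rewrite -[e1.2]/(0 : R) -[e2.2]/(1 : R); clear -p0.
  generalize (dx0 (dx0 (dx0 B)) p), (dx0 (dr (dr B)) p), (dx0 (dx0 (dr A)) p),
    (dr (dr (dr A)) p), (dr (dr A) p), (dx0 (dr B) p), (dr B p), (dr A p), (B p), (dx0 B p).
  by clifford_field.
Qed.

End AxialDiracIterates.

(** * The third order system *)

Unset Implicit Arguments.

Theorem theorem5p3 (R : realType) (D : set (R * R))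
    (f : 'rV[R]_6 -> clifford R 5) (A B : R * R -> clifford R 5)
    (hD : upper_domain D)
    (hf : axially_polyanalytic 3 D f)
    (hAB : axial_components D f A B) :
  [/\ class_C (plane_basis R) 3 D A,
      class_C (plane_basis R) 3 D B &
      forall p : R * R, D p -> let r := p.2 in
        (dx0 (dx0 (dx0 A)) p + dr (dr (dr B)) p
           - 3 *: dx0 (dx0 (dr B)) p - 3 *: dx0 (dr (dr A)) p
           - (12 / r) *: dx0 (dx0 B) p - (12 / r) *: dx0 (dr A) p
           + (8 / r) *: dr (dr B) p + (8 / r ^+ 2) *: dr B p
           - (8 / r ^+ 3) *: B p = 0)
        /\
        (dx0 (dx0 (dx0 B)) p - dr (dr (dr A)) p
           + 3 *: dx0 (dx0 (dr A)) p - 3 *: dx0 (dr (dr B)) p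
           - (12 / r) *: dx0 (dr B) p + (12 / r ^+ 2) *: dx0 B p
           - (4 / r) *: dr (dr A) p + (4 / r ^+ 2) *: dr A p = 0)].
Proof.
have [oD _ _ D0] := hD; have [_ Cf f3] := hf.
have [CA CB] := class_C_axial oD D0 Cf hAB.
split=> [||p Dp r]; [exact: CA|exact: CB|].
have [CA1 CB1] := class_C_axial_dirac oD D0 CA CB.
have [CA2 CB2] := class_C_axial_dirac oD D0 CA1 CB1.
have h1 := dirac_axial oD D0 (class_CW (class_CW CA)) (class_CW (class_CW CB)) hAB.
have h2 := dirac_axial oD D0 (class_CW CA1) (class_CW CB1) h1.
have h3 := dirac_axial oD D0 CA2 CB2 h2.
have [A3 B3] := axial_components_eq0 D0 h3 f3 Dp.
have [AE BE] := axial_dirac3 oD D0 CA CB Dp.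
rewrite AE in A3; rewrite BE in B3.
have c4 : 5%:R - 1 = 4 :> R by ring.
have c12 : 3 * 4 = 12 :> R by ring.
have c8 : 2 * 4 = 8 :> R by ring.
have c8' : 4 * (4 - 2) = 8 :> R by ring.
by move: A3 B3; rewrite c4 c8' c12 c8.
Qed.
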